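(* There is a universal constant $C>0$ such that for every $\delta\in(0,1]$ and every $\delta$-LCC configuration $V=(v_1,\ldots,v_m)\in(\mathbb{C}^d)^m$, we have $\dim(V)\le C/\delta^9$.
   Context: A list of non-zero points $(v_1,\ldots,v_m)$ in $\mathbb{C}^d$ (not necessarily distinct) is a $\delta$-LCC configuration if for every subset $\Delta\subseteq[m]$ of size at most $\delta m$ and every $i\in[m]$ there exist $j,k\in[m]\setminus\Delta$ such that either $v_i\in\{v_j,v_k\}$, or $v_i,v_j,v_k$ are three distinct collinear points. $\dim(V)$ is the dimension of the smallest affine subspace containing all points of the list. *)

(* Defs.v *)
From mathcomp Require Import all_boot all_order all_algebra.
From mathcomp Require Import complex.
From mathcomp Require Import boolp classical_sets reals.

Set Implicit Arguments.
Unset Strict Implicit.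
Unset Printing Implicit Defensive.

Import Order.TTheory GRing.Theory Num.Theory.
Local Open Scope classical_set_scope.
Local Open Scope ring_scope.

Section Affine.
Variables (K : fieldType) (d : nat).
Implicit Types (p x y z : 'rV[K]_d) (U : {vspace 'rV[K]_d}) (A : set 'rV[K]_d).

Definition translate p U : set 'rV[K]_d := [set x | x - p \in U].

Definition affine_subspace A : Prop := exists p U, A = translate p U.

Definition has_affine_dim A (n : nat) : Prop :=
  exists p U, A = translate p U /\ \dim U = n.

(* Takes the value 0 when A is not an affine subspace; in particular the empty
   set, which is not an affine subspace here, gets dimension 0. *)
Definition affine_dim A : nat := xget 0%N (has_affine_dim A).

Definition affine_hull A : set 'rV[K]_d := smallest affine_subspace A.

Definition collinear x y z : Prop :=
  exists L, [/\ has_affine_dim L 1%N, L x, L y & L z].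

Definition config_dim m (v : 'I_m -> 'rV[K]_d) : nat :=
  affine_dim (affine_hull (range v)).

(* The next lemmas show that the choice made by [affine_dim] is immaterial and
   that the hull of a non-empty list is itself an affine subspace. *)

Lemma translate_inj p q U W : translate p U = translate q W -> U = W.
Proof.
move=> /seteqP[sUW sWU].
have pW : p - q \in W by apply: sUW; rewrite /translate /= subrr mem0v.
apply/vspaceP => x; apply/idP/idP => xS.
  have : x + p - q \in W by apply: sUW; rewrite /translate /= addrK.
  by rewrite -addrA rpredDr.
have : x + p - p \in U by apply: sWU; rewrite /translate /= -addrA rpredD.
by rewrite addrK.
Qed.

Lemma affine_dim_translate p U : affine_dim (translate p U) = \dim U.
Proof.
apply: xget_unique; first by exists p, U.
by move=> n [q [W [/translate_inj-> <-]]].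
Qed.

Lemma affine_hull_range m (v : 'I_m -> 'rV[K]_d) (i0 : 'I_m) :
  affine_hull (range v)
  = translate (v i0) <<[seq v i - v i0 | i <- enum 'I_m]>>%VS.
Proof.
apply/seteqP; split.
  apply: smallest_sub; first by exists (v i0), <<[seq v i - v i0 | i <- enum 'I_m]>>%VS.
  move=> _ [i _ <-]; rewrite /translate /=; apply: memv_span.
  by apply/mapP; exists i; rewrite ?mem_enum.
move=> x xS A [[p [U ->]] sub].
have vU i : v i - p \in U by apply: sub; exists i.
have sU : (<<[seq v i - v i0 | i <- enum 'I_m]>> <= U)%VS.
  apply/span_subvP => _ /mapP[i _ ->].
  have -> : v i - v i0 = (v i - p) - (v i0 - p) by rewrite opprB addrA subrK.
  exact: rpredB.
rewrite /translate /= -[x](subrK (v i0)) -addrA rpredD //.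
exact: (subvP sU).
Qed.

End Affine.

Definition LCC_configuration (R : realType) (delta : R) (d m : nat)
    (v : 'I_m -> 'rV[R[i]]_d) : Prop :=
  (forall i, v i != 0) /\
  forall Delta : {set 'I_m}, #|Delta|%:R <= delta * m%:R ->
  forall i : 'I_m, exists j k : 'I_m,
    [/\ j \notin Delta, k \notin Delta
      & v i = v j \/ v i = v k \/
        [/\ v i != v j, v i != v k, v j != v k & collinear (v i) (v j) (v k)]].

(* Main.v *)
Require Import Defs.
From mathcomp Require Import all_boot all_order all_algebra.
From mathcomp Require Import complex.
From mathcomp Require Import boolp classical_sets reals.
From mathcomp Require Import sesquilinear spectral.
From mathcomp Require Import zify ring.
(* Restores the finite-set names shadowed by [classical_sets]. *)
From mathcomp Require Import fintype finset.
Import Order.TTheory GRing.Theory Num.Theory.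
Local Open Scope ring_scope.
Local Open Scope sesquilinear_scope.

Set Implicit Arguments.
Unset Strict Implicit.
Unset Printing Implicit Defensive.

(* An LCC configuration is linearly LCC: every vector lies in the span of two
   others avoiding Delta, a condition that survives linear quotients. Let n be
   the rank. After quotienting by a span that contains too many vectors, every
   set S of non-zero vectors satisfies |S| <= N rank S with N about m / n; the
   vectors can then be rescaled so that each diagonal entry of the orthogonal
   projection P onto the column space of the matrix is at least p = 1 / (6 N).
   The total energy, the sum of all |P i j|^2, equals tr P = n, while a
   proportional pair carries energy at least p^2 and a dependent triple at least
   p^2 / 2. The LCC condition with D excluded indices produces order D^2 such
   contributions once every triple is weighted by the inverse of the size of its
   line, so D^2 p^2 = O(n). This gives n = O(1 / delta^2), stronger than needed. *)

(** * Counting collinear triples *)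

(* A projective point-line structure on the indices: [nz i] marks the indices
   carrying a non-zero vector, [par i j] says that two of them are proportional,
   and [line i j] collects the indices lying on the span of [i] and [j]. *)
Section Counting.
Variables (T : finType) (nz : pred T) (par : rel T) (line : T -> T -> {set T}).

Definition triangle i j k :=
  [&& nz i, nz j, nz k, ~~ par i j, ~~ par i k, ~~ par j k & k \in line i j].

Hypothesis par_nz : forall i j, par i j -> nz i.
Hypothesis par_refl : forall i, nz i -> par i i.
Hypothesis par_sym : forall i j, par i j = par j i.
Hypothesis par_trans : forall i j k, par i j -> par j k -> par i k.
Hypothesis lineC : forall i j, line i j = line j i.
Hypothesis line_nz : forall i j k, k \in line i j -> nz k.
Hypothesis line_par : forall i j k, nz i -> par j k -> k \in line i j.
Hypothesis line_eq : forall i j k, nz i -> nz j -> ~~ par i j ->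
  k \in line i j -> ~~ par i k -> line i k = line i j.

Variable D : nat.
Hypothesis robust : forall (Delta : {set T}) i, (#|Delta| <= D)%N -> nz i ->
  exists j k, [/\ j \notin Delta, k \notin Delta
                & [|| par i j, par i k | triangle i j k]].

Let cls i := [set j | par i j].

Let line_r i j : nz i -> nz j -> j \in line i j.
Proof. by move=> ni nj; apply: line_par => //; apply: par_refl. Qed.

Lemma triangle_swap23 i j k : triangle i j k = triangle i k j.
Proof.
suff sw a b : triangle i a b -> triangle i b a by apply/idP/idP; apply: sw.
case/and5P=> ni na nb pia /and3P[pib pab bl].
by rewrite /triangle ni na nb pia pib par_sym pab /= (@line_eq i a b) ?line_r.
Qed.

Lemma triangle_swap12 i j k : triangle i j k = triangle j i k.
Proof.
rewrite /triangle lineC (par_sym i j).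
by case: (nz i); case: (nz j); case: (nz k); case: (par i k); case: (par j k);
  rewrite /= ?andbF.
Qed.

Lemma triangle_line13 i j k : triangle i j k -> line i k = line i j.
Proof. by case/and5P=> ni nj nk pij /and3P[pik pjk kl]; apply: line_eq. Qed.

Let cls_eq i j : par i j -> cls i = cls j.
Proof.
move=> pij; apply/setP=> l; rewrite !inE; apply/idP/idP => h.
  by apply: (par_trans _ h); rewrite par_sym.
exact: (par_trans pij).
Qed.

(** A point that is not low brings its whole class, at least [theta] indices, to every line through
    it; this outweighs any class of size at most [theta]. *)
Let low theta := [set i | nz i && (#|cls i| < theta)%N].

Let on_line theta i j := [set l in line i j | (l \notin low theta) && ~~ par i l].

(* Each line through [i] on which the low indices dominate is charged to its
   low indices. *)
Lemma card_dominated_lines theta i : nz i ->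
  (#|[set j | [&& nz j, ~~ par i j, j \notin low theta
    & (#|on_line theta i j| <= #|[set l in line i j | (l \in low theta) && ~~ par i l]|)%N]]|
   <= #|low theta|)%N.
Proof.
move=> ni; set B := [set j | _]; set L := low theta; set E := on_line theta.
have BE j : j \in B -> j \in E i j.
  by rewrite !inE => /and4P[nj pij jL _]; rewrite line_r //= pij andbT.
have E0 j : j \in B -> (0 < #|E i j|)%N.
  by move/BE => h; apply/card_gt0P; exists j.
rewrite -(ler_nat rat) -!sum1_card !natr_sum /=.
(* Each [j] in [B] sends [1 / #|E i j|] to every low [l] on its line that is not parallel to [i], at
   least 1 in total. The [j] charging a given [l] lie in [E i l], so [l] receives at most 1. *)
apply: (@le_trans _ _ (\sum_(j in B) \sum_(l in L | (l \in line i j) && ~~ par i l)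
   (#|E i j|%:R^-1 : rat))).
  apply: ler_sum => j jB; rewrite mulr1n sumr_const -[leRHS]mulr_natr.
  rewrite [leRHS]mulrC ler_pdivlMr ?ltr0n ?E0 // mul1r ler_nat.
  move: (jB); rewrite inE => /and4P[_ _ _]; move/leq_trans; apply.
  apply: subset_leq_card; apply/subsetP => l; rewrite [in X in X -> _]inE => /and3P[h1 h2 h3].
  by rewrite unfold_in /= h1 h2 h3.
rewrite (exchange_big_dep [pred l | l \in L]) /=; last by move=> j l _ /andP[].
apply: ler_sum => l lL; rewrite mulr1n.
have [pil|pil] := boolP (par i l).
  by rewrite big_pred0 ?ler01 // => j; rewrite !andbF.
have nl : nz l by move: lL; rewrite inE => /andP[].
apply: (@le_trans _ _ (\sum_(j in E i l) #|E i l|%:R^-1)).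
  have sub j : (j \in B) && ((l \in L) && ((l \in line i j) && true)) ->
      j \in E i l /\ E i j = E i l.
    case/andP=> jB /and3P[_ lj _].
    have [nj pij jL] : [/\ nz j, ~~ par i j & j \notin low theta].
      by move: jB; rewrite inE => /and4P[].
    have ll : line i l = line i j by apply: line_eq.
    have EE : E i j = E i l by rewrite /E /on_line ll.
    by rewrite -EE; split => //; apply: BE.
  rewrite [X in X <= _](eq_bigr (fun=> #|E i l|%:R^-1)); last first.
    by move=> j /sub[_ ->].
  rewrite !sumr_const ler_wpMn2l ?invr_ge0 ?ler0n //.
  by apply: subset_leq_card; apply/subsetP => j; rewrite unfold_in => /sub[].
rewrite sumr_const -[leLHS]mulr_natr.
by have [->|/lt0n_neq0 h] := posnP #|E i l|; rewrite ?mulr0 // mulVf // pnatr_eq0.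
Qed.

(** If both alternatives fail, the low indices, the class of [i], the dominated lines and the good
    indices can all be excluded, at most [D / 4] indices each. The triangle that [robust] still
    provides then forces [j] or [k] to be good. *)
Lemma robust_row theta i : nz i -> (#|cls i| <= theta)%N ->
  (4 * #|low theta| <= D)%N ->
  (D <= 4 * #|cls i|)%N \/
  (D <= 4 * #|[set j | (#|line i j| <= 6 * #|[set k | triangle i j k]|) & nz j && ~~ par i j]|)%N.
Proof.
move=> ni itheta Lsmall; set good := [set j | _].
have [|csmall] := leqP D (4 * #|cls i|); first by left.
have [|gsmall] := leqP D (4 * #|good|); first by right.
exfalso; have := card_dominated_lines theta ni; set B := [set j | _] => Bsmall.
pose Delta := low theta :|: cls i :|: B :|: good.
have Dsmall : (#|Delta| <= D)%N.
  have := cardsU (low theta :|: cls i :|: B) good.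
  have := cardsU (low theta :|: cls i) B.
  have := cardsU (low theta) (cls i).
  rewrite -/Delta; lia.
have [j [k [+ + tri]]] := robust Dsmall ni.
rewrite !in_setU !negb_or => /andP[/andP[/andP[jL jc] jB] jg] /andP[/andP[/andP[kL kc] kB] kg].
move: jc kc; rewrite !inE => pij pik.
move: tri; rewrite (negPf pij) (negPf pik) /= => tri.
have [_ nj nk _ /and3P[_ pjk kl]] := and5P tri.
have lk := triangle_line13 tri.
pose E := on_line theta i j.
have Lj : (#|[set l in line i j | (l \in low theta) && ~~ par i l]| < #|E|)%N.
  by move: jB; rewrite inE nj pij jL /= -ltnNge.
have clsE a : nz a -> a \notin low theta -> ~~ par i a -> line i a = line i j ->
    cls a \subset E.
  move=> na aL pia la; apply/subsetP=> l; rewrite !inE => pal.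
  have nl : nz l by apply: (@par_nz _ a); rewrite par_sym.
  rewrite -la line_par //= nl /= -(cls_eq pal).
  move: aL; rewrite !inE na /= => ->.
  by apply: contra pia => pil; apply: (par_trans pil); rewrite par_sym.
have thetaE : (theta <= #|E|)%N.
  apply: leq_trans (subset_leq_card (clsE j nj jL pij erefl)).
  by move: jL; rewrite inE nj /= -leqNgt.
(* [E] outnumbers the low indices because [j] is outside [B], and it is at least as large as [cls i]
   because it contains the class of [j]. *)
have l3 : (#|line i j| < 3 * #|E|)%N.
  have sub : line i j \subset
      E :|: [set l in line i j | (l \in low theta) && ~~ par i l] :|: cls i.
    apply/subsetP=> l lj; rewrite !inE lj /=.
    by case: (par i l); case: (nz l); case: (_ < _)%N.
  apply: (leq_ltn_trans (subset_leq_card sub)).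
  apply: (leq_ltn_trans (leq_card_setU _ _).1).
  rewrite mulSn addnC -addnS; apply: leq_add (leq_trans itheta thetaE) _.
  apply: (leq_ltn_trans (leq_card_setU _ _).1).
  by rewrite mulSn mul1n -addnS leq_add2l.
have triE a : nz a -> ~~ par i a -> line i a = line i j ->
    E :\: cls a \subset [set l | triangle i a l].
  move=> na pia la; apply/subsetP=> l; rewrite in_setD inE.
  case/andP=> pal; rewrite inE => /andP[ll /andP[_ pil]].
  rewrite inE in pal.
  by rewrite ?inE /triangle ni na (line_nz ll) pia pil pal la.
(* An index parallel to [j] is not parallel to [k], so [j] or [k] forms triangles with at least half
   of [E], more than a sixth of the line. *)
have cover : E \subset [set l | triangle i j l] :|: [set l | triangle i k l].
  apply/subsetP=> l lE; rewrite in_setU.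
  have [pjl|pjl] := boolP (par j l).
    apply/orP; right; apply: (subsetP (triE k nk pik lk)).
    rewrite in_setD lE andbT inE; apply: contra pjk => pkl.
    by apply: (par_trans pjl); rewrite par_sym.
  apply/orP; left; apply: (subsetP (triE j nj pij erefl)).
  by rewrite in_setD lE andbT inE.
have := leq_trans (subset_leq_card cover) (leq_card_setU _ _).1.
move: jg kg l3; rewrite !inE nj nk pij pik lk !andbT -!ltnNge.
move: #|_| #|_| #|_| #|_| => a b c e; clear.
lia.
Qed.


(** The least [theta] satisfying the second bound works. One exists because [robust] fails when all
    non-zero indices are excluded, so there are more than [D] of them. *)
Lemma threshold i0 : nz i0 -> exists theta,
  (4 * #|low theta| <= D)%N /\
  (D < 4 * #|[set i | nz i && (#|cls i| <= theta)%N]|)%N.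
Proof.
move=> ni0; pose P t := (D < 4 * #|[set i | nz i && (#|cls i| <= t)%N]|)%N.
have exP : exists t, P t.
  suff nzs : (D < #|[set i | nz i]|)%N.
    exists #|T|; rewrite /P (_ : [set i | _] = [set i | nz i]).
      by apply: leq_trans nzs _; rewrite leq_pmull.
    by apply/setP=> i; rewrite !inE max_card andbT.
  rewrite ltnNge; apply/negP => small.
  have [j [k [+ + /or3P[]]]] := robust small ni0; rewrite !inE => jn kn.
  - by rewrite par_sym => /par_nz nj; rewrite nj in jn.
  - by rewrite par_sym => /par_nz nk; rewrite nk in kn.
  - by case/and3P=> _ nj _; rewrite nj in jn.
have [theta Ptheta min] := ex_minnP exP; exists theta; split => //.
case: theta min {Ptheta} => [|t] min.
  by rewrite (_ : low 0 = set0) ?cards0 //; apply/setP=> i; rewrite !inE andbF.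
(* Class size below [t.+1] means at most [t], so the first bound is the failure of [P t]. *)
by rewrite leqNgt; apply/negP => /min; rewrite ltnn.
Qed.

(** * Weighted energy of collinear triples *)

Section Energy.
Variables (F : numFieldType) (e : T -> T -> F) (q : F).
Hypothesis e_ge0 : forall i j, 0 <= e i j.
Hypothesis q_ge0 : 0 <= q.
Hypothesis par_energy : forall i j, par i j -> q <= e i j.
Hypothesis triangle_energy : forall i j k, triangle i j k ->
  q <= 2 * (e i j + e i k + e j k).

Let w i j : F := #|line i j|%:R^-1.

Let w_ge0 i j : 0 <= w i j. Proof. by rewrite invr_ge0 ler0n. Qed.

Lemma triangle_weight i j : \sum_(k | triangle i j k) w i j <= 1.
Proof.
rewrite sumr_const -[leLHS]mulr_natr /w.
have [h|/lt0n_neq0 h] := posnP #|line i j|; first by rewrite h invr0 mul0r ler01.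
rewrite mulrC ler_pdivrMr ?ltr0n ?lt0n // mul1r ler_nat.
by apply: subset_leq_card; apply/subsetP=> k /and5P[_ _ _ _ /and3P[]].
Qed.

Lemma triangle_weighted_energy :
  \sum_i \sum_j \sum_(k | triangle i j k) w i j * e i j <= \sum_i \sum_j e i j.
Proof.
apply: ler_sum => i _; apply: ler_sum => j _.
by rewrite -mulr_suml ler_piMl // triangle_weight.
Qed.

(** The three pairs of a triangle span the same line and so have the same weight; by symmetry each
    of the three terms of [triangle_energy] sums to [S]. *)
Lemma triangle_total :
  q * (\sum_i \sum_j \sum_(k | triangle i j k) w i j) <= 6 * \sum_i \sum_j e i j.
Proof.
pose S := \sum_i \sum_j \sum_(k | triangle i j k) w i j * e i j.
have S2 : \sum_i \sum_j \sum_(k | triangle i j k) w i j * e i k = S.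
  apply: eq_bigr => i _.
  rewrite (exchange_big_dep xpredT) //=; apply: eq_bigr => j _.
  rewrite (eq_bigl (triangle i j)) => [|k]; last by rewrite triangle_swap23.
  by apply: eq_bigr => k /triangle_line13; rewrite /w => ->.
have S3 : \sum_i \sum_j \sum_(k | triangle i j k) w i j * e j k = S.
  rewrite exchange_big /=; apply: eq_bigr => i _.
  rewrite (exchange_big_dep xpredT) //=; apply: eq_bigr => j _.
  rewrite (eq_bigl (triangle i j)) => [|k]; last first.
    by rewrite triangle_swap12 triangle_swap23.
  by apply: eq_bigr => k /triangle_line13; rewrite /w (lineC k) => ->.
have -> : 6 * \sum_i \sum_j e i j = 2 * (3 * \sum_i \sum_j e i j).
  by rewrite mulrA -natrM.
apply: (@le_trans _ _ (2 * (3 * S))); last first.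
  by rewrite !ler_pM2l ?ltr0n // triangle_weighted_energy.
have -> : 3 * S = S + S + S by rewrite -[3]/((1 + 1 + 1)%N%:R) !natrD !mulrDl !mul1r.
rewrite -{2}S2 -{2}S3 /S !mulr_sumr -!big_split /= mulr_sumr.
apply: ler_sum => i _; rewrite -!big_split /= !mulr_sumr.
apply: ler_sum => j _; rewrite -!big_split /= !mulr_sumr.
apply: ler_sum => k tri.
by rewrite -!mulrDr mulrCA mulrC ler_wpM2l // triangle_energy.
Qed.

Lemma cls_total : q * \sum_i #|cls i|%:R <= \sum_i \sum_j e i j.
Proof.
rewrite mulr_sumr; apply: ler_sum => i _.
rewrite -sum1_card natr_sum mulr_sumr [leRHS](bigID (mem (cls i))) /=.
rewrite -[leLHS]addr0 lerD ?sumr_ge0 //; apply: ler_sum => j.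
by rewrite inE mulr1 => /par_energy.
Qed.

(** The bound of [robust_row] is summed over the more than [D / 4] indices of [A]. The constant is
    [592 = 4 * 4 * (1 + 6 * 6)], with one 6 from the good indices and one from [triangle_total]. *)
Lemma robust_energy i0 : nz i0 ->
  q * D%:R ^+ 2 <= 592 * \sum_i \sum_j e i j.
Proof.
move=> /threshold[theta [Lsmall Abig]]; set A := [set i | _] in Abig.
set E := \sum_i _; pose W i : F := \sum_j \sum_(k | triangle i j k) w i j.
have W_ge0 i : 0 <= W i by apply: sumr_ge0 => j _; apply: sumr_ge0.
have row i : i \in A -> D%:R <= 4 * (#|cls i|%:R + 6 * W i).
  rewrite inE => /andP[ni itheta]; rewrite mulrDr.
  have [h|h] := robust_row ni itheta Lsmall.
    rewrite -[leLHS]addr0 lerD ?mulr_ge0 ?ler0n //.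
    by rewrite -natrM ler_nat.
  rewrite -[leLHS]add0r lerD ?mulr_ge0 ?ler0n //.
  rewrite -(ler_nat F) natrM in h; apply: (le_trans h).
  rewrite ler_pM2l ?ltr0n // mulr_sumr -sum1_card natr_sum.
  set good := [set j | _]; rewrite [leRHS](bigID (mem good)) /=.
  rewrite -[leLHS]addr0 lerD //; last first.
    by apply: sumr_ge0 => j _; rewrite mulr_ge0 ?ler0n // sumr_ge0.
  apply: ler_sum => j; rewrite inE => /and3P[hj nj pij].
  rewrite mulr1n sumr_const -(mulr_natl (w i j)).
  have l0 : (0 < #|line i j|)%N by apply/card_gt0P; exists j; rewrite line_r.
  rewrite mulrA /w ler_pdivlMr ?ltr0n // mul1r -natrM ler_nat.
  by apply: leq_trans hj _; rewrite leq_mul2l subset_leq_card //; apply/subsetP=> k; rewrite inE.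
have step : q * (#|A|%:R * D%:R) <= 148 * E.
  apply: (@le_trans _ _ (q * (\sum_i 4 * (#|cls i|%:R + 6 * W i)))).
    rewrite ler_wpM2l // mulr_natl -sumr_const [leRHS](bigID (mem A)) /=.
    rewrite -[leLHS]addr0 lerD //; first exact: ler_sum.
    by apply: sumr_ge0 => j _; rewrite mulr_ge0 ?addr_ge0 ?mulr_ge0 ?ler0n.
  have := triangle_total; have := cls_total; rewrite -/E => h1 h2.
  rewrite -mulr_sumr big_split /= -mulr_sumr mulrCA mulrDr (mulrCA q 6).
  have -> : 148 * E = 4 * (E + 6 * (6 * E)) by ring.
  by rewrite ler_pM2l ?ltr0n // lerD // ler_pM2l ?ltr0n.
have -> : 592 * E = 4 * (148 * E) by ring.
apply: (@le_trans _ _ (4 * (q * (#|A|%:R * D%:R)))); last first.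
  by rewrite ler_pM2l ?ltr0n.
rewrite [leRHS]mulrCA ler_wpM2l // expr2 mulrA ler_wpM2r ?ler0n //.
by rewrite -natrM ler_nat ltnW.
Qed.

End Energy.
End Counting.

(** * Balanced scalings *)

(** Matrix determinant lemma: one block matrix is factored with either diagonal block as pivot. *)
Lemma det_rank1_update (K : fieldType) n (M : 'M[K]_n) (a : 'cV_n) (b : 'rV_n) :
  M \in unitmx ->
  \det (M + a *m b) = \det M * (1 + (b *m invmx M *m a) 0 0).
Proof.
move=> Mu.
have e1 : block_mx (1%:M : 'M_1) (- b) a M =
    block_mx 1%:M 0 a 1%:M *m block_mx 1%:M (- b) 0 (M + a *m b).
  by rewrite mulmx_block !mulmx1 !mul1mx !(mulmx0, mul0mx) !addr0 mulmxN addrCA addNr addr0.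
have e2 : block_mx (1%:M : 'M_1) (- b) a M =
    block_mx (1%:M + b *m invmx M *m a) (- b) 0 M *m block_mx 1%:M 0 (invmx M *m a) 1%:M.
  rewrite mulmx_block !mulmx1 !(mulmx0, mul0mx) !add0r mulNmx -!mulmxA addrK.
  by rewrite mulKVmx.
have := congr1 determinant e1; rewrite e2 !det_mulmx !det_ublock !det_lblock.
by rewrite !det1 !mul1r !mulr1 det_mx11 !mxE eqxx => <-; rewrite mulrC.
Qed.

Section Gram.
Variable C : numClosedFieldType.

Lemma adjmxM m n p (A : 'M[C]_(m, n)) (B : 'M[C]_(n, p)) :
  (A *m B)^t* = B^t* *m A^t*.
Proof. by rewrite trmx_mul map_mxM. Qed.

Lemma adjmxZ m n (a : C) (A : 'M[C]_(m, n)) : (a *: A)^t* = a^* *: A^t*.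
Proof. by apply/matrixP=> i j; rewrite !mxE rmorphM. Qed.

Definition gram m n (Y : 'M[C]_(m, n)) : 'M_n := Y^t* *m Y.

Lemma gram_adj m n (Y : 'M[C]_(m, n)) : (gram Y)^t* = gram Y.
Proof. by rewrite /gram adjmxM trmxCK. Qed.

Lemma mulmx_adj_ge0 n (u : 'rV[C]_n) : 0 <= (u *m u^t*) 0 0.
Proof. by rewrite mxE sumr_ge0 // => i _; rewrite !mxE mul_conjC_ge0. Qed.

Lemma gram_inv_ge0 m n (Y : 'M[C]_(m, n)) (u : 'rV_n) :
  gram Y \in unitmx -> 0 <= (u *m invmx (gram Y) *m u^t*) 0 0.
Proof.
move=> Gu; have Hadj : (invmx (gram Y))^t* = invmx (gram Y).
  by rewrite trmx_inv map_invmx gram_adj.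
have -> : u *m invmx (gram Y) *m u^t* =
   (u *m invmx (gram Y) *m Y^t*) *m (u *m invmx (gram Y) *m Y^t*)^t*.
  rewrite !adjmxM trmxCK Hadj -!mulmxA; congr (_ *m _).
  by rewrite [Y^t* *m _]mulmxA -/(gram Y) mulKmx.
exact: mulmx_adj_ge0.
Qed.

Lemma gram_col m1 m2 n (Y : 'M[C]_(m1, n)) (Z : 'M_(m2, n)) :
  gram (col_mx Y Z) = gram Y + gram Z.
Proof. by rewrite /gram tr_col_mx map_row_mx mul_row_col. Qed.

(** By [det_rank1_update], each added rank-one Gram matrix multiplies the determinant by a factor at
    least 1. *)
Lemma det_gram_add m n (Z : 'M[C]_(m, n)) (s : seq 'rV[C]_n) :
  0 < \det (gram Z) -> \det (gram Z) <= \det (gram Z + \sum_(u <- s) gram u).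
Proof.
elim: s m Z => [|u s IH] m Z Z0; first by rewrite big_nil addr0.
have Zu : gram Z \in unitmx by rewrite unitmxE unitfE gt_eqF.
have le1 : \det (gram Z) <= \det (gram Z + gram u).
  rewrite /gram det_rank1_update -/(gram Z) // ler_peMr ?(ltW Z0) //.
  by rewrite lerDl gram_inv_ge0.
rewrite big_cons addrA; apply: (le_trans le1).
by rewrite -gram_col; apply: IH; rewrite gram_col; apply: lt_le_trans le1.
Qed.

Lemma gram_sum m n (Y : 'M[C]_(m, n)) : gram Y = \sum_i gram (row i Y).
Proof.
apply/matrixP=> a b; rewrite summxE !mxE; apply: eq_bigr => i _.
by rewrite !mxE big_ord1 !mxE.
Qed.

(** This keeps one term of the Cauchy-Binet expansion: the rows outside the image of [f] only
    increase the determinant. *)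
Lemma det_gram_rowsub m n (Y : 'M[C]_(m, n)) (f : 'I_n -> 'I_m) :
  rowsub f Y \in unitmx -> `|\det (rowsub f Y)| ^+ 2 <= \det (gram Y).
Proof.
move=> Bu; set B := rowsub f Y in Bu *.
have f_inj : injective f.
  move=> a b fab; apply/eqP/negPn/negP => nab.
  move: Bu; rewrite unitmxE unitfE (determinant_alternate nab) ?eqxx //.
  by move=> j; rewrite !mxE fab.
have detB : \det (gram B) = `|\det B| ^+ 2.
  by rewrite det_mulmx det_map_mx det_tr normCK mulrC.
have -> : gram Y = gram B +
    \sum_(u <- [seq row i Y | i <- enum [pred i | i \notin codom f]]) gram u.
  rewrite gram_sum (bigID (mem (codom f))) /= big_map big_enum /=; congr (_ + _).
  rewrite gram_sum -big_uniq /=; last by rewrite map_inj_uniq ?enum_uniq.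
  by rewrite /codom big_image /=; apply: eq_bigr => b _; rewrite row_rowsub.
rewrite -detB det_gram_add // detB exprn_gt0 // normr_gt0.
by rewrite -unitfE -unitmxE.
Qed.


(** Restricting to powers of 2 makes the total weight a natural number, on which a greedy process
    can run. *)
Definition scale_rows m n (k : 'I_m -> nat) (X : 'M[C]_(m, n)) : 'M_(m, n) :=
  \matrix_(i, j) (2 ^+ k i * X i j).

Lemma row_scale_rows m n k (X : 'M[C]_(m, n)) i :
  row i (scale_rows k X) = 2 ^+ k i *: row i X.
Proof. by apply/rowP=> j; rewrite !mxE. Qed.

(** The leverage score of a row: for invertible [gram Y], a diagonal entry of the orthogonal
    projection onto the column space ([col_proj_diag]). *)
Definition leverage m n (Y : 'M[C]_(m, n)) i :=
  (row i Y *m invmx (gram Y) *m (row i Y)^t*) 0 0.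

Lemma det_gram_scale_rows m n (k : 'I_m -> nat) (X : 'M[C]_(m, n)) (f : 'I_n -> 'I_m) :
  rowsub f X \in unitmx ->
  4 ^+ (\sum_b k (f b)) * `|\det (rowsub f X)| ^+ 2 <= \det (gram (scale_rows k X)).
Proof.
move=> Bu; set Y := scale_rows k X.
have YE : rowsub f Y = diag_mx (\row_b 2 ^+ k (f b)) *m rowsub f X.
  apply/row_matrixP=> b; rewrite row_mul row_diag_mx -scalemxAl -rowE.
  by rewrite !row_rowsub row_scale_rows mxE.
have dY : \det (rowsub f Y) = 2 ^+ (\sum_b k (f b)) * \det (rowsub f X).
  rewrite YE det_mulmx det_diag; congr (_ * _).
  by rewrite -prodrXr; apply: eq_bigr => b _; rewrite mxE.
have Yu : rowsub f Y \in unitmx.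
  by rewrite unitmxE dY unitfE mulf_neq0 ?expf_neq0 ?pnatr_eq0 // -unitfE -unitmxE.
apply: le_trans (det_gram_rowsub Yu).
rewrite dY normrM exprMn normrX ger0_norm ?ler0n // -exprM mulnC exprM.
have -> : 2 ^+ 2 = 4 :> C by rewrite -natrX.
exact: lexx.
Qed.

(** Doubling row [i] adds [4 - 1 = 3] copies of its rank-one Gram matrix. *)
Lemma det_gram_bump m n (k : 'I_m -> nat) (X : 'M[C]_(m, n)) i :
  gram (scale_rows k X) \in unitmx ->
  \det (gram (scale_rows (fun j => k j + (j == i))%N X)) =
  \det (gram (scale_rows k X)) * (1 + 3 * leverage (scale_rows k X) i).
Proof.
set Y := scale_rows k X => Gu.
have -> : gram (scale_rows (fun j => k j + (j == i))%N X) =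
    gram Y + (3 *: (row i Y)^t*) *m row i Y.
  rewrite !gram_sum (bigD1 i) //= [in RHS](bigD1 i) //= [RHS]addrAC; congr (_ + _).
    rewrite !row_scale_rows eqxx addn1 exprS -scalerA; set u := 2 ^+ k i *: _.
    rewrite /gram adjmxZ conjC_nat -!scalemxAl -scalemxAr scalerA.
    by rewrite -[X in X + _]scale1r -scalerDl -natrM -(natrD _ 1 3).
  by apply: eq_bigr => j /negPf ji; rewrite !row_scale_rows ji addn0.
rewrite det_rank1_update //; congr (_ * (1 + _)).
by rewrite -scalemxAr mxE.
Qed.

(* A basis of maximal weight: exchanging a vector of the basis against a row
   shows that every row is spanned by basis vectors of at least its weight. *)
Lemma dense_basis m n (X : 'M[C]_(m, n)) (N : nat) (k : 'I_m -> nat) :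
  row_full X ->
  (forall S : {set 'I_m}, (forall i, i \in S -> row i X != 0) ->
     (#|S| <= N * \rank (\sum_(i in S) <<row i X>>)%MS)%N) ->
  (forall i, row i X = 0 -> k i = 0%N) ->
  exists2 f : 'I_n -> 'I_m, rowsub f X \in unitmx &
    (\sum_i k i <= N * \sum_b k (f b))%N.
Proof.
move=> Xfull dense supp.
have unit0 : rowsub (finfun (fullrankfun Xfull)) X \in unitmx.
  rewrite (_ : rowsub _ X = rowsub (fullrankfun Xfull) X) ?fullrowsub_unit //.
  by apply/matrixP=> a b; rewrite !mxE ffunE.
have [f fu fmax] := @arg_maxnP _ _ (fun f : {ffun 'I_n -> 'I_m} => rowsub f X \in unitmx)
  (fun f => \sum_b k (f b))%N unit0.
exists f => //; set B := rowsub f X in fu.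
have exch i b : (row i X *m invmx B) 0 b != 0 -> (k i <= k (f b))%N.
  set c := row i X *m invmx B => cb.
  have xi : row i X = \sum_a c 0 a *: row a B.
    by rewrite -mulmx_sum_row /c mulmxKV.
  (* Exchanging [f b] for [i] leaves a basis since the coefficient at [b] is non-zero. *)
  pose f' := finfun (fun a => if a == b then i else f a).
  have f'u : rowsub f' X \in unitmx.
    rewrite -row_full_unit -sub1mx; apply: (@submx_trans _ _ _ _ _ _ B).
      by rewrite sub1mx row_full_unit.
    have rowf' a : a != b -> (row a B <= rowsub f' X)%MS.
      move=> ab; rewrite -[row a B](_ : row a (rowsub f' X) = _) ?row_sub //.
      by rewrite !row_rowsub ffunE (negPf ab).
    apply/row_subP => a; have [->|ab] := eqVneq a b; last exact: rowf'.
    have -> : row b B = (c 0 b)^-1 *: (row i X - \sum_(a | a != b) c 0 a *: row a B).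
      by rewrite xi (bigD1 b) //= addrK scalerA mulVf // scale1r.
    apply: scalemx_sub; apply: addmx_sub.
      by rewrite -[row i X](_ : row b (rowsub f' X) = _) ?row_sub // row_rowsub ffunE eqxx.
    rewrite eqmx_opp; apply: summx_sub => a' a'b; apply: scalemx_sub; exact: rowf'.
  have : (\sum_a k (f' a) <= \sum_a k (f a))%N := fmax _ f'u.
  rewrite [in X in X -> _](bigD1 b) //= [X in (_ <= X)%N -> _](bigD1 b) //= ffunE eqxx.
  rewrite (eq_bigr (fun a => k (f a))) ?leq_add2r // => a /negPf ab.
  by rewrite ffunE ab.
(* By [exch], rows of weight above [t] are spanned by basis rows of weight above [t], so density
   bounds their number. *)
have level t : (#|[set i | t < k i]| <= N * #|[set b | t < k (f b)]|)%N.
  apply: leq_trans (dense _ _) _.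
    move=> i; rewrite inE => ti; apply/eqP => /supp ki; by rewrite ki in ti.
  rewrite leq_mul2l; apply/orP; right.
  apply: (@leq_trans (\rank (\sum_(b in [set b | (t < k (f b))%N]) <<row b B>>)%MS)).
    apply: mxrankS; apply/sumsmx_subP => i; rewrite inE => ti.
    rewrite genmxE -[row i X](mulmxKV fu) mulmx_sum_row.
    apply: summx_sub => b _; have [->|/exch kb] := eqVneq ((row i X *m invmx B) 0 b) 0.
      by rewrite scale0r sub0mx.
    apply: scalemx_sub; apply: (sumsmx_sup b); first by rewrite inE (leq_trans ti).
    by rewrite genmxE.
  apply: leq_trans (mxrank_sum_leqif _).1 _ => /=.
  rewrite -sum1_card; apply: leq_sum => b _.
  by rewrite mxrank_gen rank_leq_row.
(* [T] bounds every weight; [layer] writes a sum of weights as the sum of the sizes of the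
   superlevel sets. *)
pose T := (\sum_i k i + \sum_b k (f b))%N.
have layer (I : finType) (g : I -> nat) : (forall i, g i <= T)%N ->
    (\sum_i g i = \sum_(t < T) #|[set i | t < g i]|)%N.
  move=> gT; under [RHS]eq_bigr => t _ do rewrite -sum1_card big_mkcond /=.
  rewrite exchange_big /=; apply: eq_bigr => i _.
  under eq_bigr => t _ do rewrite inE.
  rewrite -big_mkcond sum1_card -[LHS](card_ord (g i)).
  rewrite -(card_image (f := widen_ord (gT i))); last first.
    by move=> a b /(congr1 val) /= ab; apply: val_inj.
  apply: eq_card => t; apply/imageP/idP.
    by case=> a _ ->; exact: (ltn_ord a).
  by move=> tg; exists (Ordinal (tg : (t < g i)%N)) => //; apply: val_inj.
rewrite (layer _ k) => [|i]; last by rewrite /T (bigD1 i) //= -!addnA leq_addr.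
rewrite (layer _ (k \o f)) => [|b]; last first.
  by rewrite /T [X in (_ <= _ + X)%N](bigD1 b) //= addnCA leq_addr.
by rewrite big_distrr /=; apply: leq_sum => t _; apply: level.
Qed.


(** The order on [C] is partial, so the bound is the inverse of 1 plus the sum of all inverses
    rather than a minimum; the 1 covers an empty [P]. *)
Lemma pos_lower_bound (I : finType) (P : pred I) (g : I -> C) :
  (forall i, P i -> 0 < g i) -> exists2 c, 0 < c & forall i, P i -> c <= g i.
Proof.
move=> g0; have S0 : 0 <= \sum_(i | P i) (g i)^-1.
  by apply: sumr_ge0 => i /g0 gi; rewrite invr_ge0 ltW.
exists (1 + \sum_(i | P i) (g i)^-1)^-1.
  by rewrite invr_gt0 ltr_wpDr.
move=> i Pi; rewrite -[g i]invrK lef_pV2 ?posrE ?invr_gt0 ?g0 ?ltr_wpDr //.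
rewrite (bigD1 i) //= addrCA lerDl addr_ge0 //.
by apply: sumr_ge0 => j /andP[/g0 gj _]; rewrite invr_ge0 ltW.
Qed.

Lemma det_gram_scale_gt0 m n (k : 'I_m -> nat) (X : 'M[C]_(m, n)) :
  row_full X -> 0 < \det (gram (scale_rows k X)).
Proof.
move=> Xfull; have Bu := fullrowsub_unit Xfull.
apply: lt_le_trans (det_gram_scale_rows k Bu).
by rewrite mulr_gt0 ?exprn_gt0 ?ltr0n // normr_gt0 -unitfE -unitmxE.
Qed.

Lemma leverage_ge0 m n (Y : 'M[C]_(m, n)) i :
  gram Y \in unitmx -> 0 <= leverage Y i.
Proof. exact: gram_inv_ge0. Qed.

(** Bernoulli's inequality gives [(1 - x) ^+ N >= 1 / 2], and [(1 + x) ^+ N * (1 - x) ^+ N <= 1]. *)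
Lemma bernoulli_growth N (x : C) : 0 <= x -> x * (2 * N%:R) <= 1 -> (1 + x) ^+ N <= 2.
Proof.
move=> x0; have [->|N0] := posnP N; first by rewrite expr0 ler1n.
move=> xN; have bern M : 1 - x <= 1 -> 0 <= 1 - x -> 1 - M%:R * x <= (1 - x) ^+ M.
  move=> h1 h2; elim: M => [|M IH]; first by rewrite mul0r subr0 expr0.
  rewrite exprS; apply: le_trans (ler_wpM2l h2 IH).
  rewrite -natr1 -subr_ge0.
  have -> : (1 - x) * (1 - M%:R * x) - (1 - (M%:R + 1) * x) = M%:R * (x * x) by ring.
  by rewrite mulr_ge0 ?ler0n // mulr_ge0.
have x1 : 0 <= 1 - x.
  rewrite subr_ge0; apply: le_trans xN; rewrite ler_peMr // -natrM ler1n.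
  by rewrite muln_gt0.
have half : 2^-1 <= (1 - x) ^+ N.
  apply: le_trans (bern N _ x1); last by rewrite gerBl.
  have -> : 2^-1 = 1 - 2^-1 :> C by field.
  rewrite lerD2l lerN2 -[leRHS]mul1r ler_pdivlMr ?ltr0n //.
  by have -> : N%:R * x * 2 = x * (2 * N%:R) by ring.
have prod1 : (1 + x) ^+ N * (1 - x) ^+ N <= 1.
  rewrite -exprMn; apply: exprn_ile1; first by apply: mulr_ge0; rewrite // addr_ge0 ?ler01.
  have -> : (1 + x) * (1 - x) = 1 - x * x by ring.
  by rewrite gerBl mulr_ge0.
rewrite -[leRHS]mul1r -ler_pdivrMr ?ltr0n //; apply: le_trans prod1.
by rewrite ler_wpM2l // exprn_ge0 // addr_ge0 ?ler01.
Qed.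

(* Raising the weight of a row of small leverage multiplies the N-th power of
   the determinant by at most 2, whereas [dense_basis] forces it to grow at
   least like 4 to the total weight. *)
Lemma exists_balanced_scaling m n (X : 'M[C]_(m, n)) (N : nat) :
  Num.archimedean_axiom C -> row_full X -> (0 < N)%N ->
  (forall S : {set 'I_m}, (forall i, i \in S -> row i X != 0) ->
     (#|S| <= N * \rank (\sum_(i in S) <<row i X>>)%MS)%N) ->
  exists k : 'I_m -> nat, forall i, row i X != 0 ->
    (6 * N)%:R^-1 <= leverage (scale_rows k X) i.
Proof.
move=> arch Xfull N0 dense.
pose Dt (k : 'I_m -> nat) := \det (gram (scale_rows k X)).
have Dt0 k : 0 < Dt k by apply: det_gram_scale_gt0.
have [c c0 cmin] : exists2 c, 0 < c & forall f : {ffun 'I_n -> 'I_m},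
    rowsub f X \in unitmx -> c <= `|\det (rowsub f X)| ^+ 2.
  apply: pos_lower_bound => f fu.
  by rewrite exprn_gt0 // normr_gt0 -unitfE -unitmxE.
have lower k : (forall i, row i X = 0 -> k i = 0%N) ->
    4 ^+ (\sum_i k i) * c ^+ N <= Dt k ^+ N.
  move=> supp; have [f fu kf] := dense_basis Xfull dense supp.
  have cf : c <= `|\det (rowsub f X)| ^+ 2.
    have fE : rowsub f X = rowsub (finfun f) X by apply/matrixP=> a b; rewrite !mxE ffunE.
    by rewrite fE; apply: cmin; rewrite -fE.
  apply: (@le_trans _ _ ((4 ^+ (\sum_b k (f b)) * c) ^+ N)).
    rewrite exprMn -exprM mulnC ler_wpM2r ?exprn_ge0 ?(ltW c0) //.
    by rewrite -!natrX ler_nat leq_pexp2l.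
  apply: lerXn2r; rewrite ?nnegrE ?(ltW (Dt0 k)) ?mulr_ge0 ?exprn_ge0 ?ler0n ?(ltW c0) //.
  apply: le_trans (det_gram_scale_rows k fu).
  by rewrite ler_wpM2l // exprn_ge0 ?ler0n.
pose good k := [forall i, (row i X != 0) ==> ((6 * N)%:R^-1 <= leverage (scale_rows k X) i)].
(* Greedy process: while the scaling is not good, a non-zero row of small leverage gains one unit of
   weight. *)
have run t : (exists k, good k) \/ exists k : 'I_m -> nat,
    [/\ forall i, row i X = 0 -> k i = 0%N, (\sum_i k i = t)%N &
        Dt k ^+ N <= Dt (fun=> 0%N) ^+ N * 2 ^+ t].
  elim: t => [|t [[k kg]|[k [supp sumk Dk]]]]; [right|by left; exists k|].
    by exists (fun=> 0%N); rewrite big1 // mulr1.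
  have [kg|] := boolP (good k); [by left; exists k|].
  rewrite negb_forall; case/existsP=> i; rewrite negb_imply => /andP[xi lev].
  right; exists (fun j => k j + (j == i))%N; split.
  - move=> j xj; rewrite supp // add0n.
    by case: eqP => // ji; rewrite -ji xj eqxx in xi.
  - rewrite big_split /= sumk (bigD1 i) //= eqxx big1 ?addn0 ?addn1 // => j /negPf ->.
    by [].
  have Gu : gram (scale_rows k X) \in unitmx.
    by rewrite unitmxE unitfE gt_eqF // Dt0.
  rewrite /Dt det_gram_bump // -/(Dt k) exprMn exprSr mulrA.
  have lev0 := leverage_ge0 i Gu.
  apply: ler_pM => //; first by rewrite exprn_ge0 // ltW.
    by rewrite exprn_ge0 // addr_ge0 ?ler01 // mulr_ge0.
  apply: bernoulli_growth; first by rewrite mulr_ge0.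
  have l6 : leverage (scale_rows k X) i <= (6 * N)%:R^-1.
    by rewrite ltW // real_ltNge ?ger0_real ?invr_ge0.
  apply: (@le_trans _ _ (3 * (6 * N)%:R^-1 * (2 * N%:R))).
    by rewrite ler_wpM2r -?natrM ?ler0n // ler_wpM2l ?ler0n.
  have N_neq0 : N%:R != 0 :> C by rewrite pnatr_eq0 -lt0n.
  by rewrite (_ : _ * _ * _ = 1) // natrM; field.
(* After [ub] steps the lower and upper bounds on [Dt k ^+ N] would give [2 ^ ub < ub]. *)
have [ub hub] := arch (Dt (fun=> 0%N) ^+ N / c ^+ N).
case: (run ub) => [[k kg]|[k [supp sumk Dk]]].
  by exists k => i xi; have /forallP/(_ i)/implyP := kg; apply.
exfalso; have := le_trans (lower k supp) Dk.
rewrite sumk (_ : 4 = 2 * 2) -?natrM // natrM exprMn mulrAC.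
rewrite ler_pM2r ?exprn_gt0 ?ltr0n // -ler_pdivlMr ?exprn_gt0 // => h.
move: hub; rewrite ger0_norm ?divr_ge0 ?exprn_ge0 ?(ltW c0) ?(ltW (Dt0 _)) // => hub.
have := le_lt_trans h hub; rewrite -natrX ltr_nat ltnNge.
by rewrite ltnW // ltn_expl.
Qed.

End Gram.

(** * Energy of the projection *)

Section Projection.
Variables (C : numClosedFieldType) (m n : nat) (Y : 'M[C]_(m, n)).
Hypothesis Gu : gram Y \in unitmx.

Definition col_proj := Y *m invmx (gram Y) *m Y^t*.

Lemma col_proj_diag i : col_proj i i = leverage Y i.
Proof.
rewrite /leverage /col_proj -row_mul !mxE; apply: eq_bigr => j _.
by rewrite !mxE.
Qed.

Lemma col_proj_adj : col_proj^t* = col_proj.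
Proof.
by rewrite /col_proj !adjmxM trmxCK trmx_inv map_invmx gram_adj mulmxA.
Qed.

Lemma col_proj_normC i j : `|col_proj i j| = `|col_proj j i|.
Proof. by rewrite -[in LHS]col_proj_adj !mxE norm_conjC. Qed.

(** The projection is self-adjoint and idempotent, so its squared Frobenius norm is its trace. *)
Lemma col_proj_energy : \sum_i \sum_j `|col_proj i j| ^+ 2 = n%:R.
Proof.
have idem : col_proj *m col_proj = col_proj.
  by rewrite /col_proj -!mulmxA [Y^t* *m (_ *m _)]mulmxA -/(gram Y) mulKVmx.
have <- : \tr col_proj = n%:R.
  by rewrite /col_proj -mulmxA mxtrace_mulC -mulmxA -/(gram Y) mulVmx // mxtrace1.
have -> : \tr col_proj = \tr (col_proj *m col_proj^t*) by rewrite col_proj_adj idem.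
apply: eq_bigr => i _; rewrite mxE.
by apply: eq_bigr => j _; rewrite !mxE normCK.
Qed.

Lemma col_proj_lincomb i j k (a b c : C) :
  a *: row i Y + b *: row j Y + c *: row k Y = 0 ->
  forall l, a * col_proj i l + b * col_proj j l + c * col_proj k l = 0.
Proof.
move=> dep l; have -> : a * col_proj i l + b * col_proj j l + c * col_proj k l =
    ((a *: row i Y + b *: row j Y + c *: row k Y) *m invmx (gram Y) *m Y^t*) 0 l.
  by rewrite !mulmxDl -!scalemxAl /col_proj -!row_mul !mxE.
by rewrite dep !mul0mx mxE.
Qed.

Variable p : C.
Hypothesis p_ge0 : 0 <= p.

(** Proportional rows make the 2 by 2 minor of the projection at [i], [j] vanish, so the product of
    the off-diagonal entries equals that of the diagonal ones. *)
Lemma parallel_energy i j (c : C) : p <= leverage Y i -> p <= leverage Y j ->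
  row i Y = c *: row j Y -> p ^+ 2 <= `|col_proj i j| ^+ 2.
Proof.
move=> pi pj ij.
have rel l : col_proj i l = c * col_proj j l.
  have := @col_proj_lincomb i j j 1 (- c) 0; rewrite scale1r scale0r addr0 ij scaleNr subrr.
  by move=> /(_ erefl l)/eqP; rewrite mul1r mul0r addr0 mulNr subr_eq0 => /eqP.
rewrite expr2 [leRHS]expr2 [X in _ <= _ * X]col_proj_normC -normrM rel.
rewrite -mulrA mulrCA -rel !col_proj_diag.
rewrite normrM !ger0_norm ?leverage_ge0 //.
by apply: ler_pM.
Qed.

(** Read in column [i] and divided by its dominant coefficient, the dependence gives [p <= x + y];
    then [(x + y) ^+ 2 <= 2 * (x ^+ 2 + y ^+ 2)]. *)
Let dominant_coef i j k (a b c : C) : p <= leverage Y i ->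
  a *: row i Y + b *: row j Y + c *: row k Y = 0 ->
  a != 0 -> `|b| <= `|a| -> `|c| <= `|a| ->
  p ^+ 2 <= 2 * (`|col_proj i j| ^+ 2 + `|col_proj i k| ^+ 2).
Proof.
move=> pi /col_proj_lincomb/(_ i) dep a0 ba ca.
set x := `|col_proj i j|; set y := `|col_proj i k|.
have le1 : p <= x + y.
  apply: (le_trans pi); rewrite -(ler_pM2l (x := `|a|)) ?normr_gt0 //.
  rewrite -[leverage _ _]ger0_norm ?leverage_ge0 // -normrM -col_proj_diag.
  have -> : a * col_proj i i = - (b * col_proj j i + c * col_proj k i).
    by apply/eqP; rewrite -addr_eq0 addrA dep.
  rewrite normrN; apply: (le_trans (ler_normD _ _)).
  rewrite !normrM [`|col_proj j i|]col_proj_normC [`|col_proj k i|]col_proj_normC mulrDr.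
  by apply: lerD; rewrite ler_wpM2r.
apply: (@le_trans _ _ ((x + y) ^+ 2)).
  by rewrite lerXn2r ?nnegrE ?addr_ge0 /x /y.
rewrite -subr_ge0.
have -> : 2 * (x ^+ 2 + y ^+ 2) - (x + y) ^+ 2 = (x - y) ^+ 2 by ring.
by rewrite -realEsqr realB ?normr_real.
Qed.

(** [dominant_coef] is applied at the index whose coefficient has the largest modulus, which is
    non-zero because [c] is. *)
Lemma dependent_energy i j k (a b c : C) :
  p <= leverage Y i -> p <= leverage Y j -> p <= leverage Y k ->
  a *: row i Y + b *: row j Y + c *: row k Y = 0 -> c != 0 ->
  p ^+ 2 <= 2 * (`|col_proj i j| ^+ 2 + `|col_proj i k| ^+ 2 + `|col_proj j k| ^+ 2).
Proof.
move=> pi pj pk dep c0.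
have [x y z] : [/\ 0 <= `|col_proj i j| ^+ 2, 0 <= `|col_proj i k| ^+ 2
  & 0 <= `|col_proj j k| ^+ 2] by rewrite !exprn_ge0.
have nz (u : C) : `|c| <= `|u| -> u != 0.
  by move=> cu; rewrite -normr_gt0; apply: lt_le_trans cu; rewrite normr_gt0.
have [ab|/ltW ba] := real_leP (normr_real a) (normr_real b).
  have [bc|/ltW cb] := real_leP (normr_real b) (normr_real c).
    have dep' : c *: row k Y + a *: row i Y + b *: row j Y = 0.
      by rewrite -dep -addrA addrC.
    apply: le_trans (dominant_coef pk dep' c0 (le_trans ab bc) bc) _.
    rewrite [`|col_proj k i|]col_proj_normC [`|col_proj k j|]col_proj_normC.
    by rewrite ler_pM2l ?ltr0n // -addrA lerDr.
  have dep' : b *: row j Y + a *: row i Y + c *: row k Y = 0.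
    by rewrite -dep [b *: _ + _]addrC.
  apply: le_trans (dominant_coef pj dep' (nz _ cb) ab cb) _.
  rewrite [`|col_proj j i|]col_proj_normC.
  by rewrite ler_pM2l ?ltr0n // addrAC lerDl.
have [ac|/ltW ca] := real_leP (normr_real a) (normr_real c).
  have dep' : c *: row k Y + a *: row i Y + b *: row j Y = 0.
    by rewrite -dep -addrA addrC.
  apply: le_trans (dominant_coef pk dep' c0 ac (le_trans ba ac)) _.
  rewrite [`|col_proj k i|]col_proj_normC [`|col_proj k j|]col_proj_normC.
  by rewrite ler_pM2l ?ltr0n // -addrA lerDr.
apply: le_trans (dominant_coef pi dep (nz _ ca) ba ca) _.
by rewrite ler_pM2l ?ltr0n // lerDl.
Qed.

End Projection.

(** * Linear LCC configurations and their rank *)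

Definition linear_LCC (K : fieldType) m n (D : nat) (X : 'M[K]_(m, n)) :=
  forall Delta : {set 'I_m}, (#|Delta| <= D)%N -> forall i, exists j k,
    [/\ j \notin Delta, k \notin Delta & (row i X <= row j X + row k X)%MS].

Section PointLine.
Variables (K : fieldType) (m n : nat) (X : 'M[K]_(m, n)).

Let nz i := row i X != 0.
Let par i j := [&& nz i, nz j & (row i X <= row j X)%MS].
Let line i j := [set k | nz k & (row k X <= row i X + row j X)%MS].

Lemma sub_nz_sym (u v : 'rV[K]_n) : u != 0 -> (u <= v)%MS -> (v <= u)%MS.
Proof.
move=> u0 /sub_rVP[a ua]; have a0 : a != 0.
  by apply: contra_neq u0 => a0; rewrite ua a0 scale0r.
by apply/sub_rVP; exists a^-1; rewrite ua scalerA mulVf // scale1r.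
Qed.

Let par_sym i j : par i j = par j i.
Proof.
by apply/idP/idP => /and3P[ni nj /sub_nz_sym h]; apply/and3P; split => //; apply: h.
Qed.

Let line_eq i j k : nz i -> nz j -> ~~ par i j ->
  k \in line i j -> ~~ par i k -> line i k = line i j.
Proof.
move=> ni nj pij; rewrite inE => /andP[nk kij] pik.
suff e : (row i X + row k X :=: row i X + row j X)%MS.
  by apply/setP=> l; rewrite !inE e.
apply/eqmxP/andP; split; rewrite addsmx_sub addsmxSl //=.
have [[a b]] := sub_addsmxP kij.
rewrite [a]mx11_scalar [b]mx11_scalar !mul_scalar_mx => xk.
have b0 : b 0 0 != 0.
  apply: contra pik => /eqP b0; rewrite par_sym /par ni nk xk b0 scale0r addr0.
  by rewrite scalemx_sub.
have -> : row j X = (b 0 0)^-1 *: (row k X - a 0 0 *: row i X).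
  by rewrite xk addrC addKr scalerA mulVf // scale1r.
by apply: scalemx_sub; apply: addmx_sub; rewrite ?addsmxSr // eqmx_opp scalemx_sub ?addsmxSl.
Qed.


(** Degenerate dependences collapse: if row [j] or row [k] vanishes, or the two are parallel, then
    row [i] is parallel to one of them. *)
Let robust D : linear_LCC D X -> forall (Delta : {set 'I_m}) i,
  (#|Delta| <= D)%N -> nz i ->
  exists j k, [/\ j \notin Delta, k \notin Delta
    & [|| par i j, par i k | triangle nz par line i j k]].
Proof.
move=> lcc Delta i small ni; have [j [k [jD kD ijk]]] := lcc _ small i.
exists j, k; split => //.
have [//|pij /=] := boolP (par i j); have [//|pik /=] := boolP (par i k).
have [/eqP j0|nj] := boolP (row j X == 0).
  rewrite j0 (adds0mx _ (row k X)) in ijk; case/negP: pik.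
  rewrite /par ni ijk andbT /=; apply: contra_neq ni => k0.
  by move: ijk; rewrite k0 => /submx0null.
have [/eqP k0|nk] := boolP (row k X == 0).
  by rewrite k0 addsmx0 in ijk; case/negP: pij; rewrite /par ni /nz nj ijk.
have pjk : ~~ par j k.
  apply: contra pik => /and3P[_ _ jk]; rewrite /par ni /nz nk /=.
  by apply: submx_trans ijk _; rewrite addsmx_sub jk submx_refl.
have il : i \in line j k by rewrite inE ni.
rewrite /triangle pij pik pjk ni /nz nj nk /=.
have ljk : line j k = line j i by apply/esym/line_eq => //; rewrite par_sym.
have -> : line i j = line j k by rewrite ljk; apply/setP=> l; rewrite !inE addsmxC.
by rewrite inE /nz nk addsmxSr.
Qed.

Lemma linear_LCC_energy (F : numFieldType) (e : 'I_m -> 'I_m -> F) (q : F) D i0 :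
  linear_LCC D X -> nz i0 -> 0 <= q -> (forall i j, 0 <= e i j) ->
  (forall i j c, nz i -> nz j -> row i X = c *: row j X -> q <= e i j) ->
  (forall i j k a b, nz i -> nz j -> nz k ->
     row k X = a *: row i X + b *: row j X -> q <= 2 * (e i j + e i k + e j k)) ->
  q * D%:R ^+ 2 <= 592 * \sum_i \sum_j e i j.
Proof.
move=> lcc ni0 q0 e0 epar etri.
apply: (@robust_energy _ nz par line _ _ _ _ _ _ _ _ D _ F e q _ _ _ _ i0) => //.
- by move=> i j /and3P[].
- by move=> i ni; rewrite /par ni submx_refl.
- move=> i j k /and3P[ni nj ij] /and3P[_ nk jk]; rewrite /par ni nk /=.
  exact: submx_trans jk.
- by move=> i j; apply/setP=> k; rewrite !inE addsmxC.
- by move=> i j k; rewrite inE => /andP[].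
- move=> i j k ni; rewrite par_sym => /and3P[nk nj kj]; rewrite inE nk /=.
  exact: submx_trans (addsmxSr _ _).
- exact: robust.
- by move=> i j /and3P[ni nj /sub_rVP[c ij]]; apply: epar ij.
move=> i j k /and5P[ni nj nk _ /and3P[_ _]]; rewrite inE => /andP[_ /sub_addsmxP[[a b]]].
by rewrite [a]mx11_scalar [b]mx11_scalar !mul_scalar_mx; apply: etri.
Qed.

End PointLine.

Lemma dense_LCC_bound (C : numClosedFieldType) m n (X : 'M[C]_(m, n)) (D N : nat) :
  Num.archimedean_axiom C -> row_full X -> (0 < n)%N -> (0 < N)%N ->
  linear_LCC D X ->
  (forall S : {set 'I_m}, (forall i, i \in S -> row i X != 0) ->
     (#|S| <= N * \rank (\sum_(i in S) <<row i X>>)%MS)%N) ->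
  (D ^ 2 <= 2 ^ 16 * n * N ^ 2)%N.
Proof.
move=> arch Xfull n0 N0 lcc dense.
have [k lev] := exists_balanced_scaling arch Xfull N0 dense.
set Y := scale_rows k X in lev; pose p : C := (6 * N)%:R^-1.
have Gu : gram Y \in unitmx by rewrite unitmxE unitfE gt_eqF // det_gram_scale_gt0.
have [i0 ni0] : exists i, row i X != 0.
  apply/existsP; rewrite -negb_forall; apply/negP => /forallP X0.
  have XE : X = 0 by apply/row_matrixP=> i; rewrite row0; apply/eqP.
  by move: Xfull; rewrite -col_leq_rank XE mxrank0 leqNgt n0.
have two_neq0 i : (2 : C) ^+ k i != 0 by rewrite expf_neq0 ?pnatr_eq0.
have rowX i : row i X = (2 ^+ k i)^-1 *: row i Y.
  by rewrite row_scale_rows scalerA mulVf // scale1r.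
have p0 : 0 <= p by rewrite invr_ge0 ler0n.
have := @linear_LCC_energy _ _ _ X C (fun i j => `|col_proj Y i j| ^+ 2) (p ^+ 2) D i0 lcc ni0.
rewrite col_proj_energy // => energy.
have {energy} : p ^+ 2 * D%:R ^+ 2 <= 592 * n%:R.
  apply: energy.
  - by rewrite exprn_ge0.
  - by move=> i j; rewrite exprn_ge0.
  - move=> i j c ni nj ij.
    apply: (@parallel_energy _ _ _ _ Gu _ p0 i j (2 ^+ k i * c * (2 ^+ k j)^-1)).
    + exact: lev.
    + exact: lev.
    by rewrite [LHS]row_scale_rows ij rowX !scalerA.
  move=> i j l a b ni nj nl ijl.
  apply: (@dependent_energy _ _ _ _ Gu _ p0 i j l (a * (2 ^+ k i)^-1) (b * (2 ^+ k j)^-1)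
    (- (2 ^+ k l)^-1)); rewrite ?lev // ?oppr_eq0 ?invr_eq0 //.
  by rewrite -!scalerA scaleNr -!rowX ijl subrr.
rewrite /p exprVn mulrC ler_pdivrMr ?exprn_gt0 ?ltr0n ?muln_gt0 //.
rewrite -!natrX -!natrM ler_nat => /leq_trans; apply.
(* [592 <= 2 ^ 10] and [6 ^ 2 <= 2 ^ 6]. *)
rewrite expnMn (expnD 2 10 6) (mulnAC (2 ^ 10)%N) -[leqRHS]mulnA.
by apply: leq_mul; rewrite leq_mul2r orbT.
Qed.

(* A span violating the density condition is quotiented out, which keeps the
   number of non-zero rows below [N] times the rank. *)
Lemma LCC_bound (C : numClosedFieldType) m n (X : 'M[C]_(m, n)) (D N : nat) :
  Num.archimedean_axiom C -> row_full X -> linear_LCC D X ->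
  (#|[set i | row i X != 0%R]| < N * n)%N ->
  (D ^ 2 <= 2 ^ 16 * n * N ^ 2)%N.
Proof.
move=> arch; have [b] := ubnP n; elim: b n X => // b IH n X nb Xfull lcc few.
have [n0 N0] : (0 < n)%N /\ (0 < N)%N.
  by apply/andP; rewrite andbC -muln_gt0; apply: leq_ltn_trans few.
pose W (S : {set 'I_m}) := (\sum_(i in S) <<row i X>>)%MS.
have [/forallP dense|] := boolP [forall S : {set 'I_m},
    [forall i in S, row i X != 0] ==> (#|S| <= N * \rank (W S))%N].
  apply: (dense_LCC_bound arch Xfull n0 N0 lcc) => S nzS.
  by have /implyP := dense S; apply; apply/forall_inP.
rewrite negb_forall; case/existsP=> S; rewrite negb_imply -ltnNge => /andP[/forall_inP nzS big].
(* Multiplication by [Q] is the quotient by [W S], in coordinates for which [X'] keeps full column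
   rank. *)
pose Q := col_base (cokermx (W S)); pose X' := X *m Q.
have Qker i : i \in S -> row i X *m Q = 0.
  move=> iS; apply: (row_free_inj (row_base_free (cokermx (W S)))).
  rewrite mul0mx -mulmxA mulmx_base; apply/eqP; rewrite -submxE.
  by apply: (sumsmx_sup i) => //; rewrite genmxE.
have nE := mxrank_coker (W S); set n' := \rank _ in nE Q X' Qker *.
have rowX' i : row i X' = row i X *m Q by rewrite row_mul.
have X'full : row_full X'.
  rewrite -col_leq_rank (eqmxMfull _ Xfull).
  by rewrite col_leq_rank col_base_full.
have lcc' : linear_LCC D X'.
  move=> Delta small i; have [j [k [jD kD ijk]]] := lcc _ small i.
  exists j, k; split => //; rewrite !rowX' -addsmxMr; exact: submxMr.
have rW : (\rank (W S) <= n)%N := rank_leq_row _.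
have nzle : (#|[set i | row i X' != 0%R]| + #|S| <= #|[set i | row i X != 0%R]|)%N.
  rewrite -cardsUI (_ : _ :&: S = set0) ?cards0 ?addn0; last first.
    apply/setP=> i; rewrite !inE; have [/Qker Qi|] := boolP (i \in S); last by rewrite andbF.
    by rewrite rowX' Qi eqxx.
  apply: subset_leq_card; apply/subsetP => i; rewrite !inE => /orP[|/nzS //].
  by apply: contra_neq; rewrite rowX' => ->; rewrite mul0mx.
(* More than [N * \rank (W S)] non-zero rows die, while the number of columns drops by
   [\rank (W S)]. *)
have few' : (#|[set i | row i X' != 0%R]| < N * n')%N.
  have -> : (N * n' = N * n - N * \rank (W S))%N by rewrite -mulnBr -nE.
  by move: nzle few big; clear; lia.
have r0 : (0 < \rank (W S))%N.
  rewrite lt0n mxrank_eq0; apply/eqP => W0.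
  move: big; rewrite W0 mxrank0 muln0 => /card_gt0P[i iS].
  have := nzS i iS; have : (row i X <= W S)%MS by apply: (sumsmx_sup i) => //; rewrite genmxE.
  by rewrite W0 submx0 => ->.
have n'n : (n' < n)%N by rewrite nE; move: r0 n0; clear; lia.
have := IH n' X' (leq_trans n'n nb) X'full lcc' few'.
move/leq_trans; apply.
by rewrite leq_mul2r leq_mul2l (ltnW n'n) !orbT.
Qed.

(** [N] is the least integer with [m < N * n], so [N * n <= 2 * m]. Multiplying [LCC_bound] by [n]
    makes [(N * n) ^ 2] appear, whence [2 ^ 18 = 2 ^ 16 * 2 ^ 2]. *)
Lemma linear_LCC_rank (C : numClosedFieldType) m d (V : 'M[C]_(m, d)) (D : nat) :
  Num.archimedean_axiom C -> linear_LCC D V ->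
  (D ^ 2 * \rank V <= 2 ^ 18 * m ^ 2)%N.
Proof.
move=> arch lcc; set n := \rank V; have [->|n0] := posnP n; first by rewrite muln0.
have rowV i : row i V = row i (col_base V) *m row_base V by rewrite -row_mul mulmx_base.
have lcc' : linear_LCC D (col_base V).
  move=> Delta small i; have [j [k [jD kD ijk]]] := lcc _ small i; exists j, k; split => //.
  by rewrite -(submxMfree _ _ (row_base_free V)) addsmxMr -!rowV.
pose N := (m %/ n).+1.
have few : (#|[set i | row i (col_base V) != 0%R]| < N * n)%N.
  apply: leq_ltn_trans (max_card _) _; rewrite card_ord.
  exact: ltn_ceil.
have := LCC_bound arch (col_base_full V) lcc' few.
rewrite -/n => bound.
have Nn : (N * n <= 2 * m)%N.
  have : (m %/ n * n <= m)%N := leq_divM m n; have : (n <= m)%N := rank_leq_row V.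
  by rewrite /N mulSn; lia.
have sq : ((N * n) ^ 2 <= 4 * m ^ 2)%N by rewrite (_ : 4 = 2 ^ 2)%N // -expnMn leq_exp2r.
apply: (@leq_trans (2 ^ 16 * (N * n) ^ 2)); last first.
  by rewrite (expnD 2 16 2) -mulnA leq_mul2l sq orbT.
rewrite expnMn; apply: leq_trans (leq_mul bound (leqnn n)) _.
by rewrite -!mulnA leq_mul2l; apply/orP; right; apply: eq_leq; ring.
Qed.

(** * Affine configurations *)

(** The direction of the line is spanned by [y - z], so [x] is an affine combination of [y] and
    [z]. *)
Lemma collinear_sub (K : fieldType) d (x y z : 'rV[K]_d) :
  y != z -> collinear x y z -> (x <= y + z)%MS.
Proof.
move=> yz [L [[p [U [-> U1]]]]]; rewrite /translate /= => xU yU zU.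
have yzU : y - z \in U by rewrite -(subrKA p) rpredD // -opprB rpredN.
have xzU : x - z \in U by rewrite -(subrKA p) rpredD // -opprB rpredN.
have Uline : <[y - z]>%VS = U.
  apply/eqP; rewrite eqEdim -memvE yzU U1 dim_vline subr_eq0 yz //.
move: xzU; rewrite -Uline => /vlineP[t xz].
have -> : x = t *: y + (1 - t) *: z.
  by rewrite -[x](subrK z) xz scalerBr scalerBl scale1r addrAC addrA.
by apply: addmx_sub_adds; apply: scalemx_sub.
Qed.

Lemma config_dim_le_rank (K : fieldType) d m (v : 'I_m -> 'rV[K]_d) :
  (config_dim v <= \rank (\matrix_i v i))%N.
Proof.
set V := \matrix_i v i; have rowV i : row i V = v i by rewrite rowK.
rewrite /config_dim; case: m v V rowV => [|m] v V rowV.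
  (* For an empty list the hull lies in the single point 0, so any dimension it has is 0, as is the
     default value of [affine_dim]. *)
  have hull0 : (affine_hull (range v) `<=` translate 0 0%VS)%classic.
    by apply: smallest_sub => [|_ [[]]//]; exists 0, 0%VS.
  rewrite /affine_dim; case: xgetP => [n _ [p [U [UE <-]]]|//].
  apply: leq_trans (leq0n _); rewrite leqn0 dimv_eq0 -subv0; apply/subvP => u uU.
  have : affine_hull (range v) (u + p) by rewrite UE /translate /= addrK.
  have : affine_hull (range v) p by rewrite UE /translate /= subrr mem0v.
  move=> /hull0; rewrite /translate /= subr0 memv0 => /eqP-> /hull0.
  by rewrite /translate /= subr0 addr0.
rewrite (affine_hull_range v ord0) affine_dim_translate.
(* The image of [f] is the row space of [V], which contains all differences; its dimension is at
   most that of the domain, [\rank V]. *)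
pose f : 'Hom('rV[K]_(\rank V), 'rV[K]_d) := linfun (mulmxr (row_base V)).
apply: (@leq_trans (\dim (limg f))).
  apply: dimvS; apply/span_subvP => _ /mapP[i _ ->].
  apply: rpredB; rewrite -rowV -[V in row _ V]mulmx_base row_mul;
    by rewrite -[_ *m _](lfunE (mulmxr (row_base V))) memv_img ?memvf.
have dimE : \dim {:'rV[K]_(\rank V)} = \rank V by rewrite dimvf /dim /= mul1n.
rewrite -[leqRHS]dimE -(limg_ker_dim f fullv).
exact: leq_addl.
Qed.

Lemma complex_archimedean (R : realType) : Num.archimedean_axiom R[i].
Proof.
move=> z; exists (Num.truncn (Normc.normc z)).+1.
have -> : `|z| = (Normc.normc z)%:C%C by [].
by rewrite -(rmorph_nat (real_complex R)) ltcR truncnS_gt.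
Qed.

Lemma LCC_linear_LCC (R : realType) (delta : R) d m (v : 'I_m -> 'rV[R[i]]_d) D :
  D%:R <= delta * m%:R -> LCC_configuration delta v -> linear_LCC D (\matrix_i v i).
Proof.
move=> Dle [_ lcc] Delta small i.
have [|j [k [jD kD h]]] := lcc Delta _ i; first by apply: le_trans Dle; rewrite ler_nat.
exists j, k; split => //; rewrite !rowK.
case: h => [->|[->|[_ _ jk col]]]; [exact: addsmxSl|exact: addsmxSr|].
exact: collinear_sub.
Qed.

Theorem theorem7p6 (R : realType) :
  exists C : R, 0 < C /\
    forall (delta : R), 0 < delta -> delta <= 1 ->
    forall (d m : nat) (v : 'I_m -> 'rV[R[i]]_d),
      LCC_configuration delta v ->
      (config_dim v)%:R <= C / delta ^+ 9.
Proof.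
(* [2 ^ 18] comes from [linear_LCC_rank], and a further [2 ^ 2] from squaring
   [delta * m%:R <= 2 * D%:R]. *)
exists (2 ^+ 20); split=> [|delta delta0 delta1 d m v lcc]; first by rewrite exprn_gt0 ?ltr0n.
set r := config_dim v; pose D := Num.truncn (delta * m%:R).
have dm0 : 0 <= delta * m%:R by rewrite mulr_ge0 ?ler0n // ltW.
have /andP[Dle ltD] := truncn_itv dm0; rewrite -/D in Dle ltD.
have rV := config_dim_le_rank v; rewrite -/r in rV.
rewrite ler_pdivlMr ?exprn_gt0 //.
have d92 : delta ^+ 9 <= delta ^+ 2 by rewrite ler_wiXn2l // ltW.
apply: (@le_trans _ _ (r%:R * delta ^+ 2)); first by rewrite ler_wpM2l ?ler0n.
(* If [D = 0] then [delta * m%:R < 1], and [r <= m] already gives [r%:R * delta ^+ 2 <= 1]. *)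
have [D0|Dpos] := posnP D.
  rewrite D0 in ltD; have rm : (r <= m)%N := leq_trans rV (rank_leq_row _).
  apply: (@le_trans _ _ 1); last by rewrite exprn_ege1 // ler1n.
  apply: (@le_trans _ _ (delta * m%:R)); last exact: ltW.
  rewrite expr2 mulrA [r%:R * _]mulrC; apply: (@le_trans _ _ (delta * r%:R)).
    by rewrite ler_piMr // mulr_ge0 ?ler0n // ltW.
  by rewrite ler_wpM2l ?ler_nat // ltW.
have m0 : (0 < m)%N.
  by rewrite lt0n; apply: contraTneq Dle => ->; rewrite mulr0 -ltNge ltr0n.
have key : (D ^ 2 * r <= 2 ^ 18 * m ^ 2)%N.
  apply: leq_trans (linear_LCC_rank (@complex_archimedean R) (LCC_linear_LCC Dle lcc)).
  by rewrite leq_mul2l rV orbT.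
have D2 : delta * m%:R <= 2 * D%:R.
  by apply: le_trans (ltW ltD) _; rewrite -natrM ler_nat; lia.
have m20 : 0 < m%:R ^+ 2 :> R by rewrite exprn_gt0 ?ltr0n.
rewrite -(ler_pM2r m20) -mulrA -exprMn.
apply: (@le_trans _ _ (r%:R * (2 * D%:R) ^+ 2)).
  by rewrite ler_wpM2l ?ler0n // lerXn2r ?nnegrE ?mulr_ge0 ?ler0n ?(ltW delta0).
rewrite -natrM -!natrX -!natrM ler_nat expnMn (expnD 2 2 18) mulnCA -mulnA.
by rewrite leq_mul2l /= mulnC.
Qed.
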